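(* Let $p$ be a prime, $n\in\mathbb{N}$ ($n\ge 1$), $q\in U^{(1)}$, and $z\in\mathbb{Z}_p$. Consider the condition $$v_p(z(z-1))\;\geq\; n-v_p(q-1)+v_p(2).\qquad ( * )$$ (1) If $( * )$ holds, then $z$ is a modular fixed point of $[\iota_q]_{p^n}$, i.e. $\iota_q(z)\equiv z\pmod{p^n}$. (2) If at least one of the following holds: $p\neq 3$; $q\in U^{(2)}$; $n\leq 2$; or $z\equiv 2\pmod 3$ (for $p=3$); then $z$ is a modular fixed point of $[\iota_q]_{p^n}$ if and only if $( * )$ holds. (3) If $p\neq 3$, or $q\in U^{(2)}$, or $n\leq 2$, then the complete set of modular fixed points of $[\iota_q]_{p^n}$ in $\mathbb{Z}_p$ is $a_0\mathbb{Z}_p\cup(1+a_0\mathbb{Z}_p)$, where $$a_0=\begin{cases} o([q]_{p^n}) & \text{if $p$ is odd},\\ 2\cdot o([q]_{2^n}) & \text{if $p=2$ and $q\in U^{(2)}$},\\ 2^n & \text{if $p=2$ and $q\in U^{(1)}-U^{(2)}$.}\end{cases}$$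
   Context: $\mathbb{Z}_p$ is the ring of $p$-adic integers with additive valuation $v_p$ ($v_p(0)=\infty$; condition $( * )$ is regarded as true when $q=1$ or $z\in\{0,1\}$), and $U^{(m)}=1+p^m\mathbb{Z}_p$. For $q\in U^{(1)}$, $\iota_q:\mathbb{Z}_p\to\mathbb{Z}_p$ is the unique continuous function with $\iota_q(k)=1+q+\cdots+q^{k-1}$ for all integers $k\ge 0$; thus $\iota_q(z)=(q^z-1)/(q-1)$ for $q\ne1$ and $\iota_1(z)=z$. $[\iota_q]_{p^n}:\mathbb{Z}_p\to\mathbb{Z}/p^n\mathbb{Z}$ is its reduction modulo $p^n$. $o([q]_{p^n})$ is the multiplicative order of $q$ in $(\mathbb{Z}/p^n\mathbb{Z})^\times$. *)

(* Defs.v *)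
From HB Require Import structures.
From mathcomp Require Import all_boot all_order all_algebra all_fingroup.
From mathcomp Require Import boolp classical_sets filter topology.
From mathcomp Require Import constructive_ereal.
From mathcomp Require Import ring.

Set Implicit Arguments.
Unset Strict Implicit.
Unset Printing Implicit Defensive.

Import Order.TTheory GRing.Theory Num.Theory.

Local Open Scope classical_set_scope.
Local Open Scope ring_scope.

(* The ring Z_p as the inverse limit of the Z/p^n: [residue x n] is the
   representative in [0, p^n) of x modulo p^n.  The single equation
   [residueE] expresses both that it is reduced and that the residues are
   compatible.  The construction makes sense for every natural number p (for
   p = 1 it is the zero ring), so only the comPzRingType structure is
   declared. *)
Record padicInt (p : nat) := PadicInt {
  residue :> nat -> int;
  residueE : forall n, residue n = (residue n.+1 %% (p ^ n)%N)%Z }.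

HB.instance Definition _ p := gen_eqMixin (padicInt p).
HB.instance Definition _ p := gen_choiceMixin (padicInt p).

Section PadicRing.
Variable p : nat.
Implicit Types x y z : padicInt p.

Lemma padicP x y : (forall n, x n = y n) -> x = y.
Proof.
case: x y => [x hx] [y hy] /= /funext xy.
by subst y; congr PadicInt; exact: Prop_irrelevance.
Qed.

Lemma residue_mod x n : (x n %% (p ^ n)%N)%Z = x n.
Proof. by rewrite {1}residueE modz_mod -residueE. Qed.

Lemma modz_pow m n (a : int) :
  (m <= n)%N -> ((a %% (p ^ n)%N)%Z %% (p ^ m)%N)%Z = (a %% (p ^ m)%N)%Z.
Proof.
move=> mn; rewrite [in RHS](intdiv.divz_eq a (p ^ n)%N).
have -> : (p ^ n)%N%:Z = (p ^ (n - m))%N%:Z * (p ^ m)%N%:Z.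
  by rewrite -PoszM -expnD subnK.
by rewrite mulrA modzMDl.
Qed.

Definition coherent (f : nat -> int) :=
  forall n, (f n.+1 = f n %[mod (p ^ n)%N])%Z.

Lemma padic_of_subproof f : coherent f -> forall n,
  (f n %% (p ^ n)%N)%Z = ((f n.+1 %% (p ^ n.+1)%N)%Z %% (p ^ n)%N)%Z.
Proof. by move=> hf n; rewrite modz_pow. Qed.

Definition padic_of f (hf : coherent f) : padicInt p :=
  PadicInt (padic_of_subproof hf).

Lemma residue_coherent x : coherent x.
Proof. by move=> n; rewrite -residueE residue_mod. Qed.

Lemma const_coherent (a : int) : coherent (fun=> a).
Proof. by []. Qed.

Lemma add_coherent x y : coherent (fun n => x n + y n).
Proof. by move=> n; rewrite -modzDm !residue_coherent modzDm. Qed.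

Lemma opp_coherent x : coherent (fun n => - x n).
Proof. by move=> n; rewrite -modzNm residue_coherent modzNm. Qed.

Lemma mul_coherent x y : coherent (fun n => x n * y n).
Proof. by move=> n; rewrite -modzMm !residue_coherent modzMm. Qed.

Let zero := padic_of (const_coherent 0).
Let one := padic_of (const_coherent 1).
Let add x y := padic_of (add_coherent x y).
Let opp x := padic_of (opp_coherent x).
Let mul x y := padic_of (mul_coherent x y).

Fact padic_addA : associative add.
Proof. by move=> x y z; apply: padicP => n /=; rewrite modzDml modzDmr addrA. Qed.
Fact padic_addC : commutative add.
Proof. by move=> x y; apply: padicP => n /=; rewrite addrC. Qed.
Fact padic_add0 : left_id zero add.
Proof. by move=> x; apply: padicP => n /=; rewrite modzDml add0r residue_mod. Qed.
Fact padic_addN : left_inverse zero opp add.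
Proof. by move=> x; apply: padicP => n /=; rewrite modzDml addNr. Qed.

HB.instance Definition _ := GRing.isZmodule.Build (padicInt p)
  padic_addA padic_addC padic_add0 padic_addN.

Fact padic_mulA : associative mul.
Proof. by move=> x y z; apply: padicP => n /=; rewrite modzMml modzMmr mulrA. Qed.
Fact padic_mulC : commutative mul.
Proof. by move=> x y; apply: padicP => n /=; rewrite mulrC. Qed.
Fact padic_mul1 : left_id one mul.
Proof. by move=> x; apply: padicP => n /=; rewrite modzMml mul1r residue_mod. Qed.
Fact padic_mulDl : left_distributive mul +%R.
Proof.
by move=> x y z; apply: padicP => n /=; rewrite modzMml modzDm mulrDl.
Qed.

HB.instance Definition _ := GRing.Zmodule_isComPzRing.Build (padicInt p)
  padic_mulA padic_mulC padic_mul1 padic_mulDl.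

Lemma residue0 n : (0 : padicInt p) n = 0.
Proof. exact: mod0z. Qed.

Lemma residue1 n : (1 : padicInt p) n = (1 %% (p ^ n)%N)%Z.
Proof. by []. Qed.

Lemma residueD x y n : (x + y) n = ((x n + y n) %% (p ^ n)%N)%Z.
Proof. by []. Qed.

Lemma residueN x n : (- x) n = ((- x n) %% (p ^ n)%N)%Z.
Proof. by []. Qed.

Lemma residueM x y n : (x * y) n = ((x n * y n) %% (p ^ n)%N)%Z.
Proof. by []. Qed.

Lemma residue_nat k n : (k%:R : padicInt p) n = (k%:Z %% (p ^ n)%N)%Z.
Proof.
elim: k => [|k IHk]; first by rewrite residue0 mod0z.
by rewrite -natr1 residueD IHk residue1 modzDm -PoszD addn1.
Qed.

Lemma residue_le x m n : (m <= n)%N -> (x n %% (p ^ m)%N)%Z = x m.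
Proof.
elim: n => [|n IHn]; first by rewrite leqn0 => /eqP->; rewrite residue_mod.
rewrite leq_eqVlt ltnS => /orP[/eqP->|mn]; first by rewrite residue_mod.
by rewrite -(modz_pow _ mn) -residueE IHn.
Qed.

Lemma residue_ppowM x n : (p%:R ^+ n * x) n = 0.
Proof.
by rewrite residueM -natrX residue_nat modzz mul0r mod0z.
Qed.

End PadicRing.

HB.instance Definition _ p := isPointed.Build (padicInt p) 0.

(* The p-adic topology: the cosets x + p^n Z_p, n : nat, form a basis of
   neighbourhoods of x. *)
Section PadicTopology.
Variable p : nat.

Definition padic_ball (x : padicInt p) (n : nat) : set (padicInt p) :=
  [set y | y n = x n].

Definition padic_nbhs (x : padicInt p) : set_system (padicInt p) :=
  filter_from setT (padic_ball x).

HB.instance Definition _ := hasNbhs.Build (padicInt p) padic_nbhs.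

Lemma padic_ball_le (x y : padicInt p) m n :
  (m <= n)%N -> y n = x n -> y m = x m.
Proof. by move=> mn xy; rewrite -(residue_le y mn) xy residue_le. Qed.

Fact padic_nbhs_filter (x : padicInt p) : ProperFilter (nbhs x).
Proof.
split; first by case=> n _ /(_ x); apply.
apply: filter_from_filter; first by exists 0.
move=> m n _ _; exists (maxn m n) => // y xy.
by split; apply: padic_ball_le xy; rewrite ?leq_maxl ?leq_maxr.
Qed.

Fact padic_nbhs_singleton (x : padicInt p) (A : set (padicInt p)) :
  nbhs x A -> A x.
Proof. by case=> n _; apply. Qed.

Fact padic_nbhs_nbhs (x : padicInt p) (A : set (padicInt p)) :
  nbhs x A -> nbhs x (nbhs^~ A).
Proof.
case=> n _ nA; exists n => // y xy; exists n => // z yz.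
by apply: nA; rewrite /padic_ball /= yz.
Qed.

HB.instance Definition _ := Nbhs_isNbhsTopological.Build (padicInt p)
  padic_nbhs_filter padic_nbhs_singleton padic_nbhs_nbhs.

End PadicTopology.

(* The additive valuation: the least n with x <> 0 modulo p^(n+1), and +oo
   when there is none.  Sums are those of extended integers, in which
   n - +oo = -oo. *)
Definition padic_val (p : nat) (x : padicInt p) : \bar int :=
  if pselect (exists n, x n.+1 != 0) is left ex
  then (ex_minn ex)%:Z%:E else +oo%E.

Section PadicVal.
Variable p : nat.
Implicit Types x : padicInt p.

Lemma residue_eq0P x n : prime p ->
  x n = 0 <-> exists y, x = p%:R ^+ n * y.
Proof.
move=> p_pr; split=> [xn0|[y ->]]; last exact: residue_ppowM.
have pn0 k : ((p ^ k)%N : int) != 0 by rewrite eqz_nat -lt0n expn_gt0 prime_gt0.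
have dvdx k : ((p ^ n)%N %| x (n + k)%N)%Z.
  by apply/dvdz_mod0P; rewrite residue_le ?leq_addr.
have hy : coherent p (fun k => (x (n + k)%N %/ (p ^ n)%N)%Z).
  move=> k; apply/eqP; rewrite eqz_mod_dvd.
  rewrite -(dvdz_mul2l (pn0 n)).
  rewrite mulrBr !(mulrC (Posz (p ^ n)%N)) !divzK // -PoszM -expnD -eqz_mod_dvd.
  by rewrite [(k + n)%N]addnC addnS; apply/eqP/residue_coherent.
exists (padic_of hy); apply: padicP => k.
rewrite -natrX residueM residue_nat /= modzMm mulrC divzK ?dvdx //.
by rewrite residue_le // leq_addl.
Qed.

Lemma padic_val_geP x n : prime p ->
  (n%:Z%:E <= padic_val x)%E <-> exists y, x = p%:R ^+ n * y.
Proof.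
move=> p_pr; apply: iff_trans (residue_eq0P x n p_pr).
rewrite /padic_val; case: pselect => [ex|nex].
  case: ex_minnP => m xm0 mmin; rewrite lee_fin lez_nat; split=> [nm|xn0].
    case: n nm => [|n] nm.
      by rewrite -residue_mod expn0 modz1.
    apply/eqP; apply: contraLR nm => /mmin.
    by rewrite -ltnNge.
  rewrite leqNgt; apply: contra xm0 => mn; apply/eqP.
  by rewrite -(residue_le x mn) xn0 mod0z.
rewrite leey; split=> // _; case: n => [|n].
  by rewrite -residue_mod expn0 modz1.
by apply/eqP/negPn/negP => xn; apply: nex; exists n.
Qed.

Lemma padic_val_eqy x : padic_val x = +oo%E <-> x = 0.
Proof.
rewrite /padic_val; case: pselect => [ex|nex]; split=> //.
- by move=> x0; exfalso; have [n] := ex; rewrite x0 residue0 eqxx.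
- move=> _; apply: padicP => -[|n]; rewrite residue0.
    by rewrite -residue_mod expn0 modz1.
  by apply/eqP/negPn/negP => xn; apply: nex; exists n.
Qed.

End PadicVal.

Definition principal_ideal (p : nat) (a : padicInt p) : set (padicInt p) :=
  [set a * y | y in setT].

Definition unit_group (p m : nat) : set (padicInt p) :=
  [set 1 + x | x in principal_ideal (p%:R ^+ m)].

(* The unique continuous interpolation of k |-> 1 + q + ... + q^(k-1);
   existence and uniqueness for q in U^(1) are [q_iotaP] and
   [q_iota_unique]. *)
Definition q_iota (p : nat) (q : padicInt p) : padicInt p -> padicInt p :=
  get [set f : padicInt p -> padicInt p |
    continuous f /\ forall k : nat, f k%:R = \sum_(i < k) q ^+ i].

Section QIota.
Variables (p : nat) (q : padicInt p).
Hypothesis p_pr : prime p.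
Hypothesis q_U1 : unit_group 1 q.

Let S (k : nat) : padicInt p := \sum_(i < k) q ^+ i.

Let SD a b : S (a + b) = S a + q ^+ a * S b.
Proof.
rewrite /S -!(big_mkord xpredT (fun i => q ^+ i)).
rewrite (big_cat_nat _ (leq_addr b a)) //=; congr +%R.
rewrite -{1}[a]add0n big_addn addKn mulr_sumr.
by apply: eq_bigr => i _; rewrite addnC exprD.
Qed.

Let qX m : exists y, q ^+ m = 1 + p%:R * y.
Proof.
case: q_U1 => _ [y _ <-] <-; rewrite expr1.
elim: m => [|m [z hz]]; first by exists 0; rewrite mulr0 addr0.
exists (y + z * (1 + p%:R * y)); rewrite exprS hz; ring.
Qed.

Let S_ppow n : exists y, S (p ^ n) = p%:R ^+ n * y.
Proof.
elim: n => [|n [y hy]]; first by exists 1; rewrite /S expn0 big_ord1 !expr0 mul1r.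
have SM k : S (p ^ n * k) = S (p ^ n) * \sum_(i < k) q ^+ (p ^ n * i).
  elim: k => [|k IHk]; first by rewrite muln0 /S !big_ord0 mulr0.
  by rewrite mulnS addnC SD IHk big_ord_recr /= mulrDr [q ^+ _ * _]mulrC.
have [w hw] : exists w, \sum_(i < p) q ^+ (p ^ n * i) = p%:R * w.
  have sumE k : exists w, \sum_(i < k) q ^+ (p ^ n * i) = k%:R + p%:R * w.
    elim: k => [|k [w hw]]; first by exists 0; rewrite big_ord0 mulr0 addr0.
    have [v hv] := qX (p ^ n * k).
    exists (w + v); rewrite big_ord_recr /= hw hv -natr1; ring.
  have [w hw] := sumE p.
  by exists (1 + w); rewrite hw mulrDr mulr1.
exists (y * w); rewrite expnSr SM hy hw exprSr; ring.
Qed.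

Let S_ppowM n k : exists y, S (p ^ n * k) = p%:R ^+ n * y.
Proof.
elim: k => [|k [y hy]]; first by exists 0; rewrite muln0 /S big_ord0 mulr0.
have [w hw] := S_ppow n.
by exists (w + q ^+ (p ^ n) * y); rewrite mulnS SD hw hy; ring.
Qed.

Let S_mod n a : S (a %% p ^ n) n = S a n.
Proof.
rewrite [in RHS](divn_eq a (p ^ n)) addnC SD.
have [y hy] := S_ppowM n (a %/ p ^ n); rewrite mulnC hy.
by rewrite mulrCA residueD residue_ppowM addr0 residue_mod.
Qed.

Let nat_of (z : padicInt p) n := `|z n|%N.

Let nat_ofE z n : (nat_of z n)%:Z = z n.
Proof.
rewrite /nat_of gez0_abs // -residue_mod modz_ge0 //.
by rewrite eqz_nat -lt0n expn_gt0 prime_gt0.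
Qed.

Let nat_of_mod z n : (nat_of z n.+1 %% p ^ n = nat_of z n)%N.
Proof.
by apply/eqP; rewrite -eqz_nat -modz_nat !nat_ofE -residueE.
Qed.

Let interp_coherent z : coherent p (fun n => S (nat_of z n) n).
Proof.
move=> n; rewrite -residueE residue_mod.
by rewrite -[LHS]S_mod nat_of_mod.
Qed.

Let interp z := padic_of (interp_coherent z).

Let interp_nat k : interp k%:R = S k.
Proof.
apply: padicP => n; rewrite /= residue_mod -[RHS]S_mod; congr (S _ n).
by rewrite /nat_of residue_nat modz_nat.
Qed.

Let interp_continuous : continuous interp.
Proof.
move=> z A [n _ nA]; exists n => // w wz; apply: nA.
by rewrite /padic_ball /= /nat_of wz.
Qed.

Lemma q_iotaP : continuous (q_iota q) /\
  forall k : nat, q_iota q k%:R = \sum_(i < k) q ^+ i.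
Proof.
rewrite /q_iota; case: xgetP => [f _ //|].
by move=> /(_ interp); case; split; [exact: interp_continuous|exact: interp_nat].
Qed.

Lemma q_iota_unique (f : padicInt p -> padicInt p) : continuous f ->
  (forall k : nat, f k%:R = \sum_(i < k) q ^+ i) -> f = q_iota q.
Proof.
have [gc gk] := q_iotaP; move=> fc fk; apply/funext => z; apply: padicP => n.
have [m1 _ m1P] := fc z _ (ex_intro2 _ _ n I (fun=> id)).
have [m2 _ m2P] := gc z _ (ex_intro2 _ _ n I (fun=> id)).
pose m := maxn m1 m2.
have zm : ((nat_of z m)%:R : padicInt p) m = z m.
  by rewrite residue_nat nat_ofE residue_mod.
have /= <- := m1P (nat_of z m)%:R (padic_ball_le (leq_maxl m1 m2) zm).
have /= <- := m2P (nat_of z m)%:R (padic_ball_le (leq_maxr m1 m2) zm).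
by rewrite fk gk.
Qed.

End QIota.

(* Meant for n >= 1, so that 'Z_(p ^ n) is Z/p^n. *)
Definition reduction (p n : nat) (x : padicInt p) : 'Z_(p ^ n) := (x n)%:~R.

Definition modular_fixed_point (p n : nat) (f : padicInt p -> 'Z_(p ^ n))
  (z : padicInt p) := f z = reduction n z.

(* The order is taken in the unit group of Z/p^n, of which the reduction of
   any q in U^(1) is an element ([reduction_unit]). *)
Definition mult_order (p n : nat) (q : padicInt p) : nat :=
  #[insubd (1%g : {unit 'Z_(p ^ n)}) (reduction n q)]%g.

Lemma reduction_unit (p n : nat) (q : padicInt p) :
  prime p -> (0 < n)%N -> unit_group 1 q -> reduction n q \is a GRing.unit.
Proof.
move=> p_pr n0 [_ [y _ <-] <-]; rewrite expr1.
set x := 1 + _.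
have pn1 : (1 < p ^ n)%N by rewrite -{1}(exp1n n) ltn_exp2r // prime_gt1.
have xge0 : 0 <= x n.
  by rewrite -residue_mod modz_ge0 // eqz_nat -lt0n expn_gt0 prime_gt0.
rewrite /reduction -(gez0_abs xge0) -[_%:~R]/(_%:R) unitZpE //.
rewrite coprime_pexpl // prime_coprime //; apply/negP => /eqP dvd.
have : x 1%N = 0.
  by rewrite -(residue_le x n0) -(gez0_abs xge0) modz_nat expn1 dvd.
rewrite /x residueD -[p%:R]expr1 residue_ppowM addr0 residue1 expn1 modz_mod.
by rewrite modz_small //= ltz_nat prime_gt1.
Qed.

(* With v(0) = +oo, this holds when q = 1 or z \in {0, 1}
   ([valuation_condition_conv]). *)
Definition valuation_condition (p n : nat) (q z : padicInt p) : Prop :=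
  (padic_val (z * (z - 1))%R >=
     n%:Z%:E - padic_val (q - 1)%R + padic_val (2%R : padicInt p))%E.

Lemma valuation_condition_conv (p n : nat) (q z : padicInt p) :
  q = 1 \/ z = 0 \/ z = 1 -> valuation_condition n q z.
Proof.
rewrite /valuation_condition; case=> [->|z01].
  by rewrite subrr (padic_val_eqy 0).2 // addeNy addNye leNye.
have -> : z * (z - 1) = 0 by case: z01 => ->; rewrite ?mul0r // subrr mulr0.
by rewrite (padic_val_eqy 0).2 // leey.
Qed.

Definition a0 (p n : nat) (q : padicInt p) : nat :=
  if odd p then mult_order n q
  else if q \in unit_group 2 then (2 * mult_order n q)%N
  else (2 ^ n)%N.

(* Main.v *)
(* Choosing natural numbers k and 1 + t close to z and q, the difference
   iota_q(z) - z is approximated by the sum over j >= 1 of C(k, j+1) t^j.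
   Twice its first term is k (k-1) t, whose valuation is the one in condition
   ( * ), and the identity
     (j+1) j C(k, j+1) t^j = k (k-1) t * C(k-2, j-1) t^(j-1)
   shows that the later terms have strictly larger valuation, because
   v_p((j+1) j) < (j-1) v_p(t) + v_p(2); the only exception is j = 2, p = 3,
   v_3(t) = 1, where the factor C(k-2, 1) helps when k = 2 mod 3.  The same
   comparison applied to (1 + t)^k - 1 = k t + ... (lifting the exponent)
   identifies the order of q modulo p^n. *)
Require Import Defs.
From HB Require Import structures.
From mathcomp Require Import all_boot all_order all_algebra all_fingroup.
From mathcomp Require Import boolp classical_sets filter topology.
From mathcomp Require Import constructive_ereal.
From mathcomp Require Import cyclic ring zify.

Set Implicit Arguments.
Unset Strict Implicit.
Unset Printing Implicit Defensive.

Import Order.TTheory GRing.Theory Num.Theory.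

Local Open Scope nat_scope.

(** * Binomial expansion and divisibility by prime powers in the naturals *)

Lemma geometric_sum_binomial t k :
  \sum_(i < k) t.+1 ^ i = \sum_(j < k) 'C(k, j.+1) * t ^ j.
Proof.
elim: k => [|k IHk]; first by rewrite !big_ord0.
rewrite big_ord_recr /= IHk; under [in RHS]eq_bigr do rewrite binS mulnDl.
rewrite big_split /= big_ord_recr /= bin_small // mul0n addn0; congr addn.
rewrite -addn1 addnC expnDn; apply: eq_bigr => i _.
by rewrite exp1n mul1n.
Qed.

(** Valuations give v(x) = v(b) + v(y) - v(a). In the uses, [a] is a denominator such as (j+1)j, [b]
    the leading term, and [e] the gain of [x] over that term. *)
Lemma pfactor_dvdn_cancel p m e w a b x y : prime p -> 0 < a ->
  a * x = b * y -> p ^ m %| b -> p ^ w %| y -> logn p a + e <= w ->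
  p ^ (m + e) %| x.
Proof.
move=> p_pr a0 axby pb py ew; have [->|x0] := posnP x; first exact: dvdn0.
have : p ^ (m + w) %| a * x by rewrite axby expnD dvdn_mul.
by rewrite !pfactor_dvdn ?muln_gt0 ?a0 // lognM //; lia.
Qed.

(* Each power of p dividing B + R divides B by induction on the exponent, so no
   valuation of B (possibly 0) is needed. *)
Lemma dvdn_add_higher p B R : (forall m, p ^ m %| B -> p ^ m.+1 %| R) ->
  forall m, (p ^ m %| B + R) = (p ^ m %| B).
Proof.
move=> hR m; apply/idP/idP => [|pB]; last first.
  by rewrite dvdn_addr // (dvdn_trans _ (hR _ pB)) // dvdn_exp2l.
elim: m => [|m IHm] pBR; first by rewrite dvd1n.
have pB : p ^ m %| B by apply/IHm/(dvdn_trans _ pBR); rewrite dvdn_exp2l.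
by rewrite -(dvdn_addl _ (hR _ pB)).
Qed.

Lemma logn_lt p a m : 0 < a -> a < p ^ m -> logn p a < m.
Proof.
move=> a0; apply: contraLR; rewrite -!leqNgt => ma.
by rewrite dvdn_leq // (dvdn_trans _ (pfactor_dvdnn p a)) // dvdn_exp2l.
Qed.

(** Of two consecutive integers at most one is divisible by p, so the sum of their valuations is the
    larger one. *)
Lemma logn_mulSn p j : logn p (j.+1 * j) = maxn (logn p j.+1) (logn p j).
Proof.
have [->|j0] := posnP j; first by rewrite muln0 logn0 maxn0 logn1.
rewrite lognM //; have [pj|pj] := boolP (p %| j); last first.
  have -> : logn p j = 0 by apply/eqP; rewrite lognE (negPf pj) !andbF.
  by rewrite addn0 maxn0.
suff -> : logn p j.+1 = 0 by rewrite add0n max0n.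
rewrite lognE; case: ifP => // /and3P[p_pr _ pj1].
rewrite -addn1 dvdn_addr // dvdn1 in pj1.
by have := prime_gt1 p_pr; case: eqP pj1 => // ->.
Qed.

(** It suffices that j + 1 stays below p to the power on the right; at p = 3, j = 2 this reads 3 < 3
    and fails. *)
Lemma logn_mulSn_lt p j : prime p -> 1 < j -> p <> 3 \/ 2 < j ->
  logn p (j.+1 * j) < j.-1 + (p == 2).
Proof.
move=> p_pr j1 hj; have p1 := prime_gt1 p_pr.
have big : j.+1 < p ^ (j.-1 + (p == 2)).
  case: eqP => [p2|p2].
    case: j j1 {hj} => [|[|j]] // _; rewrite addn1 /= p2 !expnS.
    have := ltn_expl j (isT : 1 < 2); lia.
  rewrite addn0; have := ltn_expl (j - 3) p1; have := ltn_expl (j - 2) p1.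
  case: (p =P 3) hj => p3 hj.
    case: j j1 hj => [|[|[|j]]] // _ []//= _.
    by rewrite !subSS subn0 !expnS; lia.
  case: j j1 {hj} => [|[|j]] //= _; rewrite !subSS subn0 expnS => lt1 _.
  have : 4 * p ^ j <= p * p ^ j by rewrite leq_mul2r; lia.
  lia.
by rewrite logn_mulSn gtn_max !logn_lt // ?(ltn_trans (ltnSn j)) // ltnW.
Qed.

Lemma logn_mulSn_le p j : prime p -> 1 < j ->
  logn p (j.+1 * j) <= j.-1 + (p == 2).
Proof.
move=> p_pr j1; have [->|p3] := p =P 3; last first.
  by apply/ltnW/logn_mulSn_lt => //; left.
have [j3|j2] := ltnP 2 j; first by apply/ltnW/logn_mulSn_lt; auto.
by have -> : j = 2 by lia.
Qed.

(** * Divisibility of the defect by powers of p, and lifting the exponent *)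

(** For q = 1 + t this is iota_q(k) - k: the term j = 0 of the expansion, equal to k, is left
    out. *)
Definition fixed_point_defect t k := \sum_(1 <= j < k) 'C(k, j.+1) * t ^ j.

Lemma geometric_sum_defect t k :
  \sum_(i < k) t.+1 ^ i = k + fixed_point_defect t k.
Proof.
rewrite geometric_sum_binomial /fixed_point_defect.
case: k => [|k]; first by rewrite big_ord0 big_geq.
rewrite -(big_mkord xpredT (fun j => 'C(k.+1, j.+1) * t ^ j)).
by rewrite big_ltn // bin1 muln1.
Qed.

Lemma double_defect t k : 2 * fixed_point_defect t k =
  k * k.-1 * t + \sum_(2 <= j < k) 2 * ('C(k, j.+1) * t ^ j).
Proof.
rewrite /fixed_point_defect.
case: k => [|[|k]]; try by rewrite !big_geq ?muln0.
by rewrite big_ltn // mulnDr big_distrr /= expn1 mulnA -mul_bin_diag bin1.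
Qed.

(** Two absorptions: (j+1) C(k, j+1) = k C(k-1, j) and j C(k-1, j) = (k-1) C(k-2, j-1). *)
Lemma defect_term t k j : 0 < j -> j.+1 * j * (2 * ('C(k, j.+1) * t ^ j)) =
  k * k.-1 * t * (2 * ('C(k.-2, j.-1) * t ^ j.-1)).
Proof.
case: j => // j _; have h1 := mul_bin_diag k j.+1.
have h2 := mul_bin_diag k.-1 j; rewrite /= expnS.
transitivity (2 * t * t ^ j * (j.+1 * (j.+2 * 'C(k, j.+2)))); first ring.
rewrite -h1 [j.+1 * (k * _)]mulnCA -h2; ring.
Qed.

Section Defect.
Variables (p t k : nat).
Hypotheses (p_pr : prime p) (pt : p %| t).

Lemma defect_term_dvd m w e j : 1 < j ->
  p ^ m %| k * k.-1 * t -> p ^ w %| 2 * ('C(k.-2, j.-1) * t ^ j.-1) ->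
  logn p (j.+1 * j) + e <= w -> p ^ (m + e) %| 2 * ('C(k, j.+1) * t ^ j).
Proof.
move=> j1 pB pw; apply: pfactor_dvdn_cancel (defect_term t k _) pB pw => //.
  by rewrite muln_gt0 /=; lia.
lia.
Qed.

Lemma dvdn_power_weight r c j : p ^ r %| t -> p ^ c %| 'C(k.-2, j.-1) ->
  p ^ (r * j.-1 + (p == 2) + c) %| 2 * ('C(k.-2, j.-1) * t ^ j.-1).
Proof.
move=> pr pc; rewrite [r * _ + _]addnC -addnA !expnD; apply: dvdn_mul.
  by case: eqP => [->|_]; rewrite ?dvd1n.
by rewrite mulnC dvdn_mul // expnM dvdn_exp2r.
Qed.

(** One direction only asks that later terms be at least as divisible as the leading one, so
    equality at p = 3, j = 2 is harmless. *)
Lemma dvdn_double_defect_if m :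
  p ^ m %| k * k.-1 * t -> p ^ m %| 2 * fixed_point_defect t k.
Proof.
move=> pB; rewrite double_defect dvdn_add // big_seq; apply: dvdn_sum => j.
rewrite mem_index_iota => /andP[j1 _]; rewrite -[m]addn0.
apply: (defect_term_dvd j1 pB (dvdn_power_weight (r := 1) (c := 0) _ _)) => //.
by rewrite mul1n !addn0 logn_mulSn_le.
Qed.

Lemma dvdn_double_defect m : [\/ p <> 3, p ^ 2 %| t | k = 2 %[mod 3]] ->
  (p ^ m %| 2 * fixed_point_defect t k) = (p ^ m %| k * k.-1 * t).
Proof.
move=> hyp; rewrite double_defect; apply: dvdn_add_higher => {}m pB.
rewrite big_seq; apply: dvdn_sum => j; rewrite mem_index_iota => /andP[j1 jk].
have [p3|p3] := p =P 3; last first.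
  rewrite -addn1.
  apply: (defect_term_dvd j1 pB
    (dvdn_power_weight (r := 1) (c := 0) _ _)) => //.
  by rewrite mul1n !addn0 addn1; apply: logn_mulSn_lt; auto.
have [j2|j2] := ltnP 2 j.
  rewrite -addn1.
  apply: (defect_term_dvd j1 pB
    (dvdn_power_weight (r := 1) (c := 0) _ _)) => //.
  by rewrite mul1n !addn0 addn1; apply: logn_mulSn_lt; auto.
(* The critical term p = 3, j = 2: the denominator 6 costs one factor 3. It is regained from t when
   9 divides t, or from C(k-2, 1) = k - 2 when k = 2 mod 3. *)
have {j1 j2} -> : j = 2 by lia.
rewrite -addn1; have log3 : logn p (3 * 2) = 1 by rewrite p3.
case: hyp => [//|p2t|k2].
  apply: (defect_term_dvd (isT : 1 < 2) pB
    (dvdn_power_weight (c := 0) p2t _)) => //.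
  by rewrite log3.
apply: (defect_term_dvd (isT : 1 < 2) pB
  (dvdn_power_weight (r := 1) (c := 1) _ _)) => //.
  by rewrite /= bin1 p3; lia.
by rewrite log3; lia.
Qed.

(** The factor 2 is prime to p for odd p and costs exactly one power when p = 2; this is the summand
    v_p(2) of the condition. *)
Lemma dvdn_defect n :
  (p ^ n %| fixed_point_defect t k) =
  (p ^ (n + (p == 2)) %| 2 * fixed_point_defect t k).
Proof.
case: eqP => [->|/eqP p2]; first by rewrite addn1 expnS dvdn_pmul2l.
rewrite addn0 Gauss_dvdr // coprimeXl // prime_coprime // dvdn_prime2 //.
Qed.

Lemma fixed_point_natP n :
  [\/ p <> 3, p ^ 2 %| t, n <= 2 | p = 3 /\ k = 2 %[mod 3]] ->
  (p ^ n %| fixed_point_defect t k) = (p ^ (n + (p == 2)) %| k * k.-1 * t).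
Proof.
rewrite dvdn_defect => -[p3|p2t|n2|[p3 k2]];
  try by rewrite dvdn_double_defect; auto using Or31, Or32, Or33.
have [p3|p3] := p =P 3; last first.
  by rewrite dvdn_double_defect //; apply: Or31.
have [k2|k2] := k %% 3 =P 2.
  by rewrite dvdn_double_defect //; apply: Or33.
(* With p = 3, n <= 2 and k not 2 mod 3, both sides are true: 3 divides k(k-1) and 3 divides t. *)
suff pB : p ^ (n + (p == 2)) %| k * k.-1 * t.
  by rewrite pB dvdn_double_defect_if.
rewrite p3 addn0; apply: (dvdn_trans (dvdn_exp2l _ n2)); rewrite expnS expn1.
apply: dvdn_mul; last by rewrite -p3.
case: k k2 => // k' k2; rewrite Euclid_dvdM //; lia.
Qed.

(** Lifting the exponent: the leading term k t dominates, since (j+1) C(k, j+1) t^(j+1) = k t C(k-1,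
    j) t^j and v_p(j+1) < v_p(t^j) for t nonzero. *)
Lemma dvdn_expSn_sub1 m : p <> 2 \/ p ^ 2 %| t ->
  (p ^ m %| t.+1 ^ k - 1) = (p ^ m %| k * t).
Proof.
move=> hyp.
have -> : t.+1 ^ k - 1 = k * t + \sum_(1 <= j < k) 'C(k, j.+1) * t ^ j.+1.
  rewrite subn1 predn_exp /= geometric_sum_defect mulnDr mulnC; congr addn.
  by rewrite big_distrr /=; apply: eq_bigr => j _; rewrite expnS mulnCA.
apply: dvdn_add_higher => {}m pB; rewrite big_seq; apply: dvdn_sum => j.
rewrite mem_index_iota => /andP[j0 jk].
(* The bound 3 serves j + 1 < 3^j <= p^(rj); with 2 in place of 3 it would fail at j = 1. *)
have [r [prt pr3]] : exists r, p ^ r %| t /\ 3 <= p ^ r.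
  have p1 := prime_gt1 p_pr; case: hyp => [p2|p2t].
    by exists 1; rewrite expn1; lia.
  by exists 2; split=> //; rewrite expnS expn1; nia.
rewrite -addn1; apply: (@pfactor_dvdn_cancel p m 1 (r * j) j.+1 (k * t) _
  ('C(k.-1, j) * t ^ j)) => //.
- by rewrite mulnA -mul_bin_diag expnS; ring.
- by rewrite dvdn_mull // expnM dvdn_exp2r.
rewrite addn1; apply: logn_lt => //; rewrite expnM.
apply: (@leq_trans (3 ^ j)); last by rewrite leq_exp2r.
case: j j0 {jk} => // j _; rewrite expnS.
by have := ltn_expl j (isT : 1 < 3); lia.
Qed.

End Defect.

Local Open Scope classical_set_scope.
Local Open Scope ring_scope.

(** * Passage from p-adic integers to natural approximations *)

Section PadicApproximation.
Variable p : nat.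
Hypothesis p_pr : prime p.
Implicit Types x y q z : padicInt p.

Lemma residue_nat_eq0 k m : (k%:R : padicInt p) m = 0 <-> (p ^ m %| k)%N.
Proof. by rewrite residue_nat modz_nat; split=> [[/eqP]|/eqP->]. Qed.

Lemma residue_nat_eq k l m :
  (k%:R : padicInt p) m = (l%:R : padicInt p) m <-> k = l %[mod p ^ m].
Proof. by rewrite !residue_nat !modz_nat; split=> [[]|->]. Qed.

Lemma padic_nat_approx x N : exists k : nat, x N = (k%:R : padicInt p) N.
Proof.
exists `|x N|%N; rewrite residue_nat gez0_abs ?residue_mod //.
by rewrite -residue_mod modz_ge0 // eqz_nat -lt0n expn_gt0 prime_gt0.
Qed.

(** Here x has valuation exactly r, so its natural approximation is p^r times a number prime to p,
    which cancels. *)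
Lemma residueM_eq0 x y m r : x r = 0 -> x r.+1 <> 0 ->
  (y * x) (m + r)%N = 0 <-> y m = 0.
Proof.
move=> xr xr1; have [a xa] := padic_nat_approx x (m + r).+1.
have [b yb] := padic_nat_approx y (m + r).+1.
have le i : (i <= (m + r).+1)%N -> x i = (a%:R : padicInt p) i.
  by move=> ile; apply: padic_ball_le ile xa.
have pra : (p ^ r %| a)%N by apply/residue_nat_eq0; rewrite -le //; lia.
have pr1a : ~ (p ^ r.+1 %| a)%N by rewrite -residue_nat_eq0 -le //; lia.
rewrite (padic_ball_le (leq_trans (leq_addr r m) (leqnSn _)) yb) residueM.
rewrite (padic_ball_le (leqnSn _) yb) (padic_ball_le (leqnSn _) xa).
rewrite -residueM -natrM !residue_nat_eq0.
have [a' a'E] := dvdnP pra; rewrite a'E mulnA expnD.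
rewrite dvdn_pmul2r ?expn_gt0 ?prime_gt0 // Gauss_dvdl // coprimeXl //.
rewrite prime_coprime //; apply/negP => pa'; apply: pr1a.
by rewrite a'E expnS dvdn_mul.
Qed.

Lemma padic_val_fin x : x <> 0 ->
  exists r : nat, [/\ padic_val x = r%:Z%:E, x r = 0 & x r.+1 <> 0].
Proof.
move=> x0; case vx: (padic_val x) => [v||].
- have : v%:E = padic_val x by [].
  rewrite /padic_val; case: pselect => // ex [vE].
  case: ex_minnP vE => r /eqP xr1 _ vr; exists r; rewrite vr; split=> //.
  apply/(residue_eq0P x r p_pr)/(padic_val_geP x r p_pr).
  by rewrite vx vr.
- by case: x0; apply/padic_val_eqy.
- by move: vx; rewrite /padic_val; case: pselect.
Qed.

Lemma padic_val2 : padic_val (2%:R : padicInt p) = (p == 2)%:Z%:E.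
Proof.
have p1 := prime_gt1 p_pr.
have n2 : (2%:R : padicInt p) <> 0.
  move=> /(congr1 (fun x : padicInt p => x 2%N)); rewrite residue0.
  by move=> /residue_nat_eq0/dvdn_leq; rewrite expnS expn1; nia.
have [r [-> /residue_nat_eq0 r2 r12]] := padic_val_fin n2.
have -> : r = (p == 2)%N; last by [].
have := pfactor_dvdn r p_pr (isT : (0 < 2)%N); rewrite r2 => /esym rle.
have /negP : ~ (r.+1 <= logn p 2)%N.
  by rewrite -pfactor_dvdn // => /residue_nat_eq0.
move: rle; rewrite logn_prime //; lia.
Qed.

(** Moving v_p(q-1) to the left turns the inequality of valuations into a single divisibility, which
    also covers q = 1 and can be tested on natural approximations. *)
Lemma valuation_conditionE n q z :
  valuation_condition n q z <->
  (z * (z - 1) * (q - 1)) (n + (p == 2))%N = 0.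
Proof.
have [->|/eqP q1] := eqVneq q 1.
  split=> _; last by apply: valuation_condition_conv; left.
  by rewrite subrr mulr0 residue0.
have q10 : q - 1 <> 0 by move=> /eqP; rewrite subr_eq0 => /eqP.
have [r [vr qr qr1]] := padic_val_fin q10.
rewrite /valuation_condition vr padic_val2.
set v := (p == 2)%N; set y := z * (z - 1).
rewrite (_ : (_ + _)%E = (n%:Z - r%:Z + v%:Z)%:E) //.
(* If v_p(q-1) exceeds n + v, the lower bound is negative and q - 1 alone already vanishes at level
   n + v, so both sides hold. *)
have [rle|/ltnW rgt] := leqP r (n + v).
  have -> : n%:Z - r%:Z + v%:Z = (n + v - r)%N%:Z by lia.
  rewrite -{2}(subnK rle) residueM_eq0 //.
  apply: iff_trans (padic_val_geP _ _ p_pr) _.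
  by apply: iff_sym; apply: residue_eq0P.
split=> _.
  by rewrite residueM -[(q - 1) _](residue_le _ rgt) qr mod0z mulr0 mod0z.
have: (0%N%:Z%:E <= padic_val y)%E.
  by apply/(padic_val_geP y 0 p_pr); exists y; rewrite expr0 mul1r.
by apply: le_trans; rewrite lee_fin; lia.
Qed.

Lemma unit_groupE m q : unit_group m q <-> (q - 1) m = 0.
Proof.
split=> [[_ [y _ <-] <-]|/(residue_eq0P _ _ p_pr)[y qE]].
  by rewrite addrC addKr residue_ppowM.
by exists (p%:R ^+ m * y); [exists y|rewrite -qE addrC subrK].
Qed.

Lemma residue_geometric_sum x y N k : x N = y N ->
  (\sum_(i < k) x ^+ i) N = (\sum_(i < k) y ^+ i) N.
Proof.
move=> xy; have xyX i : (x ^+ i) N = (y ^+ i) N.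
  by elim: i => // i IHi; rewrite !exprS !residueM IHi xy.
elim: k => [|k IHk]; first by rewrite !big_ord0.
by rewrite !big_ord_recr !residueD IHk /= xyX.
Qed.

Lemma reduction_eq n x y : (0 < n)%N ->
  reduction n x = reduction n y <-> x n = y n.
Proof.
move=> n0; split=> [|xy]; last by rewrite /reduction xy.
have p1 : (1 < p ^ n)%N by rewrite -{1}(exp1n n) ltn_exp2r // prime_gt1.
have [a xa] := padic_nat_approx x n; have [b yb] := padic_nat_approx y n.
rewrite /reduction xa yb !residue_nat !modz_nat -!pmulrn.
by move=> /(congr1 val); rewrite /= !val_Zp_nat // !modn_mod => ->.
Qed.

Lemma mult_order_dvdn n q t k : (0 < n)%N -> unit_group 1 q ->
  q n = (t.+1%:R : padicInt p) n ->
  (mult_order n q %| k)%N = (p ^ n %| t.+1 ^ k - 1)%N.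
Proof.
move=> n0 qU qt; have p1 : (1 < p ^ n)%N.
  by rewrite -{1}(exp1n n) ltn_exp2r // prime_gt1.
rewrite /mult_order order_dvdn -val_eqE FinRing.val_unitX.
rewrite insubdK ?reduction_unit // /reduction qt residue_nat modz_nat -pmulrn.
rewrite Zp_nat_mod // FinRing.val_unit1.
rewrite -natrX -[X in _ == X]/(1%:R) -val_eqE /= !val_Zp_nat //.
by rewrite Zp_cast // eqn_mod_dvd // expn_gt0.
Qed.

Lemma principal_idealE s x : principal_ideal ((p ^ s)%N%:R) x <-> x s = 0.
Proof.
rewrite natrX; split=> [[y _ <-]|/(residue_eq0P _ _ p_pr)[y ->]].
  exact: residue_ppowM.
by exists y.
Qed.

(** Continuity of iota_q lets a natural k near z replace z. The level [N] is left free so that the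
    same t and k can also express the valuation condition. *)
Lemma modular_fixed_point_approx n q z N : (0 < n)%N -> unit_group 1 q ->
  (n <= N)%N -> exists t k : nat,
  [/\ (q - 1) N = (t%:R : padicInt p) N, z N = (k%:R : padicInt p) N &
    modular_fixed_point (reduction n \o q_iota q) z <->
    (p ^ n %| fixed_point_defect t k)%N].
Proof.
move=> n0 qU nN; have [iota_cont iota_nat] := q_iotaP p_pr qU.
(* Continuity gives no explicit modulus [m], so z is approximated to level [maxn m N]. *)
have [m _ mP] := iota_cont z _ (ex_intro2 _ _ n I (fun=> id)).
have [t qt] := padic_nat_approx (q - 1) N.
have [k zk] := padic_nat_approx z (maxn m N).
exists t, k; split; [by []|exact: padic_ball_le (leq_maxr m N) zk|].
have /= zn := mP k%:R (esym (padic_ball_le (leq_maxl m N) zk)).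
have qn : q n = (t.+1%:R : padicInt p) n.
  rewrite -natr1 -[q](subrK 1) (residueD (q - 1)) (padic_ball_le nN qt).
  by rewrite -residueD.
rewrite /modular_fixed_point /= reduction_eq //.
rewrite -zn iota_nat (residue_geometric_sum _ qn).
rewrite (padic_ball_le (leq_trans nN (leq_maxr m N)) zk).
under eq_bigr do rewrite -natrX; rewrite -natr_sum geometric_sum_defect.
rewrite residue_nat_eq; split=> [/eqP|hd]; last apply/eqP.
  by rewrite eqn_mod_dvd ?leq_addr // addKn.
by rewrite eqn_mod_dvd ?leq_addr // addKn.
Qed.

Lemma natr_mul_pred k : (k%:R : padicInt p) * (k%:R - 1) = (k * k.-1)%:R.
Proof.
case: k => [|k]; first by rewrite mul0r.
by rewrite natrM -{2}natr1 addrK.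
Qed.

End PadicApproximation.

(** * The number a_0 and the set of fixed points *)

(** A prime cannot divide both k and k - 1, so one of them absorbs all of p^s; hence the two
    cosets. *)
Lemma pfactor_dvdn_mul_pred p s k : prime p ->
  (p ^ s %| k * k.-1)%N = (p ^ s %| k)%N || (p ^ s %| k.-1)%N.
Proof.
move=> p_pr; case: k => [|k]; first by rewrite mul0n dvdn0.
apply/idP/orP => [|[]]; [|exact: dvdn_mulr|exact: dvdn_mull].
have [pk|pk] := boolP (p %| k)%N; last first.
  by rewrite Gauss_dvdl ?coprimeXl ?prime_coprime //; left.
rewrite Gauss_dvdr; first by right.
rewrite coprimeXl // prime_coprime // -addn1 dvdn_addr // dvdn1.
by have := prime_gt1 p_pr; case: p {p_pr pk} => [|[]].
Qed.

(** Rewrites the valuation condition as divisibility of k(k-1) by a_0. Level [n.+2] is fine enough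
    to see both p^(n+v_p(2)) and membership in U^(2). *)
Lemma a0P (p n t : nat) (q : padicInt p) : prime p -> (0 < n)%N ->
  unit_group 1 q -> (q - 1) n.+2 = (t%:R : padicInt p) n.+2 ->
  exists s, [/\ a0 n q = (p ^ s)%N, (s <= n.+1)%N &
    forall k, (p ^ (n + (p == 2)) %| k * k.-1 * t)%N = (p ^ s %| k * k.-1)%N].
Proof.
move=> p_pr n0 qU qt.
have qn : q n = (t.+1%:R : padicInt p) n.
  rewrite -natr1 -[q](subrK 1) (residueD (q - 1)).
  by rewrite (padic_ball_le (leq_trans (leqnSn _) (leqnSn _)) qt) -residueD.
have tE m : (m <= n.+2)%N -> unit_group m q <-> (p ^ m %| t)%N.
  by move=> mn; rewrite unit_groupE // (padic_ball_le mn qt) residue_nat_eq0.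
have pt : (p %| t)%N by rewrite -[p]expn1; apply/tE.
have orderE : p <> 2%N \/ (p ^ 2 %| t)%N ->
    exists2 s, (s <= n)%N & mult_order n q = (p ^ s)%N /\
      forall k, (p ^ s %| k)%N = (p ^ n %| k * t)%N.
  move=> hyp; have ordE k : (mult_order n q %| k)%N = (p ^ n %| k * t)%N.
    by rewrite (mult_order_dvdn p_pr _ n0 qU qn) dvdn_expSn_sub1.
  (* Taking k = p^n shows that the order is a power of p. *)
  have /(dvdn_pfactor _ _ p_pr)[s sn oE] : (mult_order n q %| p ^ n)%N.
    by rewrite ordE dvdn_mulr.
  by exists s => //; split=> // k; rewrite -oE ordE.
rewrite /a0; case: ifPn => p_odd.
  have p2 : p <> 2%N by move=> p2; rewrite p2 in p_odd.
  have [s sn [-> sE]] := orderE (or_introl p2).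
  exists s; split=> [//||k]; first exact: leqW.
  by rewrite sE; move/eqP: p2 => /negPf->; rewrite addn0.
have p2 : p = 2%N by case: (even_prime p_pr) p_odd => // ->.
have -> : (p == 2)%N by rewrite p2.
have half k : (k * k.-1 = 2 * 'C(k, 2))%N by rewrite -mul_bin_diag bin1.
case: ifPn => [|]; rewrite ?notin_setE ?inE => q2.
  (* The order is applied to C(k, 2) = k(k-1)/2, whence the factor 2 in a_0. *)
  have [s sn [-> sE]] := orderE (or_intror ((tE 2%N isT).1 q2)).
  exists s.+1; split=> [||k]; first by rewrite expnS p2.
    by [].
  by rewrite half addn1 !expnS -mulnA {1 3}p2 !dvdn_pmul2l // sE.
exists n; split=> [||k]; [by rewrite p2|exact: leqnSn|].
(* Outside U^(2), t = 2u with u odd, so t removes exactly one factor 2 from 2^(n+1). *)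
have [u tu] := dvdnP pt; rewrite tu p2 addn1 expnSr mulnA dvdn_pmul2r //.
rewrite Gauss_dvdl // coprimeXl // prime_coprime //.
apply/negP => u2; apply: q2.
by apply/tE => //; rewrite tu p2 expnS dvdn_mul.
Qed.

Theorem theorem4p2 (p n : nat) (q : padicInt p)
    (p_prime : prime p) (n_gt0 : (0 < n)%N) (q_U1 : unit_group 1 q) :
  let iota_mod : padicInt p -> 'Z_(p ^ n) := reduction n \o q_iota q in
  [/\ forall z : padicInt p,
        valuation_condition n q z -> modular_fixed_point iota_mod z,
      forall z : padicInt p,
        [\/ p <> 3%N, unit_group 2 q, (n <= 2)%N |
            p = 3%N /\ reduction 1 z = reduction 1 2%:R] ->
        modular_fixed_point iota_mod z <-> valuation_condition n q z &
      [\/ p <> 3%N, unit_group 2 q | (n <= 2)%N] ->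
        [set z | modular_fixed_point iota_mod z] =
        principal_ideal (a0 n q)%:R `|`
        [set 1 + x | x in principal_ideal (a0 n q)%:R] ].
Proof.
move=> iota_mod.
have natural (z : padicInt p) : exists t k : nat,
  [/\ (q - 1) n.+2 = (t%:R : padicInt p) n.+2,
      z n.+2 = (k%:R : padicInt p) n.+2,
      modular_fixed_point iota_mod z <-> (p ^ n %| fixed_point_defect t k)%N &
      valuation_condition n q z <->
        (p ^ (n + (p == 2)) %| k * k.-1 * t)%N].
  have n2 : (n <= n.+2)%N by rewrite -addn2 leq_addr.
  have [t [k [qt zk fixE]]] :=
    modular_fixed_point_approx p_prime z n_gt0 q_U1 n2.
  exists t, k; split=> //; rewrite valuation_conditionE //.
  have le : (n + (p == 2%N) <= n.+2)%N by case: eqP; lia.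
  have {}qt := padic_ball_le le qt; have {}zk := padic_ball_le le zk.
  rewrite -residue_nat_eq0 // natrM -natr_mul_pred.
  by rewrite residueM qt residueM (residueD z) zk -residueD -!residueM.
have tE m t : (m <= n.+2)%N -> (q - 1) n.+2 = (t%:R : padicInt p) n.+2 ->
    unit_group m q -> (p ^ m %| t)%N.
  move=> mn qt; rewrite unit_groupE // (padic_ball_le mn qt).
  by move/residue_nat_eq0.
have part2 (z : padicInt p) : [\/ p <> 3%N, unit_group 2 q, (n <= 2)%N |
    p = 3%N /\ reduction 1 z = reduction 1 2%:R] ->
    modular_fixed_point iota_mod z <-> valuation_condition n q z.
  have [t [k [qt zk -> ->]]] := natural z => hyp.
  have pt : (p %| t)%N by rewrite -[p]expn1; apply: tE qt q_U1.
  rewrite fixed_point_natP //; case: hyp => [||| [p3]].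
  - exact: Or41.
  - by move/(tE _ _ _ qt) => p2t; apply: Or42; apply: p2t.
  - exact: Or43.
  - move=> /(reduction_eq p_prime _ _ (ltn0Sn 0)) z2; apply: Or44; split=> //.
    rewrite (padic_ball_le (isT : (1 <= n.+2)%N) zk) in z2.
    by move/residue_nat_eq: z2; rewrite expn1 {1 2}p3.
split=> // [z|hyp].
  have [t [k [qt zk -> ->]]] := natural z => pB.
  have pt : (p %| t)%N by rewrite -[p]expn1; apply: tE qt q_U1.
  by rewrite dvdn_defect // dvdn_double_defect_if.
apply/predeqP => z /=.
apply: iff_trans (part2 z _) _.
  by case: hyp => ?; [exact: Or41|exact: Or42|exact: Or43].
have [t [k [qt zk _ ->]]] := natural z.
have [s [-> sn sE]] := a0P p_prime n_gt0 q_U1 qt.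
rewrite sE pfactor_dvdn_mul_pred //.
have {}zk := padic_ball_le (leqW sn) zk.
have shift : [set 1 + x | x in principal_ideal ((p ^ s)%N%:R)] z <->
    (z - 1) s = 0.
  rewrite -principal_idealE //; split=> [[x px <-]|pz].
    by rewrite addrC addKr.
  by exists (z - 1) => //; rewrite addrC subrK.
apply: (@iff_trans _ (z s = 0 \/ (z - 1) s = 0)); last first.
  split=> -[h|h]; [left|right|left|right]; try exact/shift.
  - exact/principal_idealE.
  - by move/(principal_idealE p_prime): h.
rewrite (residueD z) zk -residueD.
(* The truncated [k.-1] represents z - 1 only for k > 0; for k = 0 the first coset settles the
   claim. *)
case: k zk {sE} => [|k] zk.
  by rewrite residue0 dvdn0; split=> // _; left.
have -> : k.+1%:R - 1 = k%:R :> padicInt p by rewrite -natr1 addrK.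
rewrite !residue_nat_eq0.
by split=> /orP.
Qed.
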